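(* Let $(\Omega, \mathcal{F}, \mathbf{P})$ be a probability space and let $T \colon \Omega \to \Omega$ be a measurable map that is measure-preserving, i.e. $\mathbf{P}(T^{-1}A) = \mathbf{P}(A)$ for all $A \in \mathcal{F}$. Let $\mathcal{I} := \{A \in \mathcal{F} : T^{-1}A = A\}$ be the $\sigma$-field of invariant events. Let $X_1$ be a real-valued random variable on $\Omega$ with finite mean, and write $X_n := X_1 \circ T^{n-1}$ for $n = 2, 3, \ldots$. If $S_n := X_1 + \cdots + X_n$ for all $n \in \mathbf{N}$, then \[ \frac{S_n}{n} \to \mathbf{E}[X_1 \mid \mathcal{I}] \qquad \text{almost surely as } n \to \infty. \]
   Context: $\mathbf{N} = \{1,2,3,\ldots\}$. ''Finite mean'' means that $X_1$ is integrable, $\mathbf{E}|X_1| < \infty$. $T^{n-1}$ denotes the $(n-1)$-fold composition of $T$ with itself, and $\mathbf{E}[X_1 \mid \mathcal{I}]$ is the conditional expectation of $X_1$ given $\mathcal{I}$. *)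

(* Defs.v *)
From HB Require Import structures.
From mathcomp Require Import all_boot all_order all_algebra.
From mathcomp Require Import all_classical all_reals all_analysis.
From mathcomp Require Import measurable_realfun.

Set Implicit Arguments.
Unset Strict Implicit.
Unset Printing Implicit Defensive.

Import Order.TTheory GRing.Theory Num.Theory.
Import numFieldNormedType.Exports.

Local Open Scope classical_set_scope.
Local Open Scope ring_scope.

Definition measure_preserving (d : measure_display) (Omega : measurableType d)
    (R : realType) (P : probability Omega R) (T : Omega -> Omega) : Prop :=
  measurable_fun [set: Omega] T /\
  forall A : set Omega, measurable A -> P (T @^-1` A) = P A.

Definition invariant_events (d : measure_display) (Omega : measurableType d)
    (T : Omega -> Omega) : set (set Omega) :=
  [set A | measurable A /\ T @^-1` A = A].

(* [Y] is a version of the conditional expectation of [X] given the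
   sub-sigma-field [G]: [G]-measurable, integrable, and with the same integral
   as [X] over every event of [G].  For integrable [X], a version exists by
   [is_cond_exp_exists]. *)
Definition is_cond_exp (d : measure_display) (Omega : measurableType d)
    (R : realType) (P : probability Omega R) (G : set (set Omega))
    (X Y : Omega -> R) : Prop :=
  [/\ forall B : set R, measurable B -> G (Y @^-1` B),
      P.-integrable [set: Omega] (EFin \o Y)
    & forall A : set Omega, G A ->
        (\int[P]_(w in A) (Y w)%:E = \int[P]_(w in A) (X w)%:E)%E].

(* [X_n = X_1 \o T^(n-1)] for [n >= 1]; the value at [n = 0] is irrelevant. *)
Definition iterate_rv (Omega : Type) (R : realType) (T : Omega -> Omega)
    (X1 : Omega -> R) (n : nat) : Omega -> R :=
  X1 \o iter n.-1 T.

Definition partial_sum (Omega : Type) (R : realType) (X : nat -> Omega -> R)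
    (n : nat) (w : Omega) : R :=
  \sum_(1 <= k < n.+1) X k w.

Lemma sigma_algebra_invariant_events (d : measure_display)
    (Omega : measurableType d) (T : Omega -> Omega) :
  sigma_algebra [set: Omega] (invariant_events T).
Proof.
split=> [|A [mA TA]|F IF]; split.
- exact: measurable0.
- exact: preimage_set0.
- by rewrite setTD; exact: measurableC.
- by rewrite setTD -preimage_setC TA.
- by apply: bigcup_measurable => k _; have [] := IF k.
- by rewrite preimage_bigcup; apply: eq_bigcupr => k _; have [] := IF k.
Qed.

Lemma is_cond_exp_exists (d : measure_display) (Omega : measurableType d)
    (R : realType) (P : probability Omega R) (G : set (set Omega))
    (X : Omega -> R) :
  sigma_algebra [set: Omega] G -> G `<=` measurable ->
  P.-integrable [set: Omega] (EFin \o X) ->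
  exists Y : Omega -> R, is_cond_exp P G X Y.
Proof.
move=> sG Gm iX.
pose S : measurableType G.-sigma := g_sigma_algebraType G.
have GE : @measurable _ S = G by exact: sigma_algebra_id.
pose i : Omega -> S := idfun.
have mi : measurable_fun [set: Omega] i.
  move=> _ B; rewrite GE setTI => GB; exact: (Gm B GB).
pose mi' := isMeasurableFun.Build _ _ _ _ i mi.
pose I : {mfun Omega >-> S} := HB.pack i mi'.
pose mu : probability S R := distribution P I.
pose nu0 : {charge set Omega -> \bar R} := induced_charge iX.
pose c : set S -> \bar R := nu0.
have nc0 : c set0 = 0%E by rewrite /c charge0.
have ncfin (A : set S) : measurable A -> c A \is a fin_num.
  rewrite GE => GA; change (nu0 A \is a fin_num).
  exact: fin_num_measure (Gm _ GA).
have ncs : semi_sigma_additive c.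
  rewrite /semi_sigma_additive GE => F mF tF mUF.
  exact: (@charge_semi_sigma_additive _ Omega R nu0 F
    (fun n => Gm _ (mF n)) tF (Gm _ mUF)).
pose nuC := isCharge.Build _ S R c nc0 ncfin ncs.
pose nu : {charge set S -> \bar R} := HB.pack c nuC.
have numu : nu `<< mu.
  apply/null_content_dominatesP => A; rewrite GE => GA muA.
  have mA : measurable (A : set Omega) := Gm _ GA.
  apply: (@null_set_integral _ Omega R P A) => //.
  by have /integrableP[mX _] := integrableS measurableT mA (@subsetT _ A) iX.
pose f : S -> \bar R := Radon_Nikodym nu mu.
have iff : mu.-integrable [set: S] f by exact: Radon_Nikodym_integrable.
have mf : measurable_fun [set: S] f by have /integrableP[] := iff.
pose Y : Omega -> R := fine \o f.
have YE : EFin \o Y = f.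
  by apply/funext => w; rewrite /= fineK//; exact: Radon_Nikodym_fin_num.
have iY : P.-integrable [set: Omega] (EFin \o Y).
  rewrite YE; apply/integrableP; split.
    exact: (measurableT_comp mf mi).
  have /integrableP[_] := iff.
  rewrite /mu /distribution (ge0_integral_pushforward mi)//.
  exact: measurableT_comp.
exists Y; split => // [B mB|A GA].
  rewrite -GE -[X in measurable X]setTI.
  by apply: (measurableT_comp _ mf).
rewrite (_ : (fun w => (Y w)%:E) = f) -?YE//.
have mA : @measurable _ S A by rewrite GE.
have <- : c A = (\int[P]_(w in A) (X w)%:E)%E by [].
have -> : c A = (\int[mu]_(x in A) f x)%E := Radon_Nikodym_integral numu mA.
rewrite /mu /distribution (integral_pushforward mi mf) ?YE//.
apply: (integrableS measurableT) => //; first exact: Gm.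
by rewrite -[f \o I]/f -YE.
Qed.

(* Main.v *)
Require Import Defs.
From mathcomp Require Import all_boot all_order all_algebra.
From mathcomp Require Import all_classical all_reals all_analysis.
From mathcomp Require Import measurable_realfun lra.
Set Implicit Arguments.
Unset Strict Implicit.
Unset Printing Implicit Defensive.

Import Order.TTheory GRing.Theory Num.Theory.
Import numFieldNormedType.Exports.
Local Open Scope classical_set_scope.
Local Open Scope ring_scope.

(** The proof derives the ergodic theorem from a maximal inequality, in the
style of Garsia.  For a function [f] let [M_n] be the maximum of [0] and of the
first [n] sums [f + f \o T + ...] along the orbit.  Conditioning on the first
step of the orbit gives [M_{n+1} = max(0, f + M_n \o T)], that is,
[M_{n+1} - M_n \o T = max(f, - M_n \o T)].

Let [A] be the set where [M_n] is unbounded.  The recursion shows that [A] is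
invariant, so [T] preserves integrals over [A], and since [M_n <= M_{n+1}] the
integral of [max(f, - M_n \o T)] over [A] is nonnegative.  On [A] these
functions converge to [f], dominated by [|f|]; hence the integral of [f] over
[A] is nonnegative ([integral_unbounded_sums_ge0]).

Suppose that [f] integrates to [0] over every invariant event.  The inequality
for [f - e] gives [0 <= - e * P A], so for every [e > 0] the sums of [f - e]
are almost surely bounded above: the [n]th sum of [f] is at most [e * n] plus a
constant ([ae_partial_sum_le]).

The conditional expectation [Y] is itself invariant, so the [n]th sum of
[X1 - Y] is [S_n - n * Y].  The upper bounds for [X1 - Y] and for [Y - X1]
together say that [S_n / n] converges to [Y].  Working with boundedness rather
than with an upper limit keeps the exceptional set exactly invariant and avoids
extended-real limits. *)

(** * Invariance of integrals *)

Section measure_preserving.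
Context (d : measure_display) (Omega : measurableType d) (R : realType).
Context (P : probability Omega R) (T : Omega -> Omega).
Context (hT : measure_preserving P T).

Lemma integrable_comp_measure_preserving (f : Omega -> \bar R) :
  P.-integrable [set: Omega] f -> P.-integrable [set: Omega] (f \o T).
Proof.
case: hT => mT PT /integrableP[mf foo]; apply/integrableP; split.
  exact: measurableT_comp.
have mabs : measurable_fun [set: Omega] (abse \o f) by exact: measurableT_comp.
rewrite (_ : (\int[P]_x `|(f \o T) x|)%E = (\int[P]_x `|f x|)%E)//.
rewrite -[RHS](@eq_measure_integral _ _ _ _ P (pushforward P T))/=; last first.
  by move=> A mA _; rewrite /pushforward PT.
by rewrite ge0_integral_pushforward// preimage_setT.
Qed.

(** Change of variables, the image of [P] under [T] being [P] itself. *)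
Lemma integral_comp_measure_preserving (f : Omega -> \bar R) (A : set Omega) :
  P.-integrable [set: Omega] f -> measurable A ->
  (\int[P]_(x in T @^-1` A) f (T x) = \int[P]_(x in A) f x)%E.
Proof.
move=> intf mA; have [mT PT] := hT.
rewrite -[RHS](@eq_measure_integral _ _ _ A P (pushforward P T))/=; last first.
  by move=> B mB _; rewrite /pushforward PT.
rewrite integral_pushforward//; first by case/integrableP: intf.
apply: (integrableS measurableT) => //.
  by rewrite -[X in measurable X]setTI; exact: mT.
exact: integrable_comp_measure_preserving.
Qed.

End measure_preserving.

(** * Sums along an orbit and their running maxima *)

Section partial_sum.
Context (Omega : Type) (R : realType) (T : Omega -> Omega).
Implicit Types f g : Omega -> R.

(** Splitting off the first step of the orbit, rather than the last one, is what
matches the recursion for the maxima. *)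
Lemma partial_sumS f n w :
  partial_sum (iterate_rv T f) n.+1 w =
  f w + partial_sum (iterate_rv T f) n (T w).
Proof.
rewrite /partial_sum big_nat_recl//; congr (_ + _).
by apply: eq_big_nat => -[|i]// _; rewrite /iterate_rv/= -iterSr.
Qed.

Lemma partial_sumB f g n w :
  partial_sum (iterate_rv T (f \- g)) n w =
  partial_sum (iterate_rv T f) n w - partial_sum (iterate_rv T g) n w.
Proof. by rewrite /partial_sum -sumrB. Qed.

Lemma partial_sum_invariant f n w : (forall x, f (T x) = f x) ->
  partial_sum (iterate_rv T f) n w = f w * n%:R.
Proof.
move=> fT; elim: n w => [|n IH] w; first by rewrite /partial_sum big_geq// mulr0.
by rewrite partial_sumS IH fT -natr1 mulrDr mulr1 addrC.
Qed.

(** The maximum of the partial sums of orders [0] to [n].  Taking its first-step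
recursion as the definition makes the increment identity behind the maximal
inequality immediate. *)
Fixpoint max_partial_sum f n w : R :=
  if n is m.+1 then Num.max 0 (f w + max_partial_sum f m (T w)) else 0.

Lemma max_partial_sum_ge0 f n w : 0 <= max_partial_sum f n w.
Proof. by case: n => //= n; rewrite le_max lexx. Qed.

Lemma partial_sum_le_max f n w :
  partial_sum (iterate_rv T f) n w <= max_partial_sum f n w.
Proof.
elim: n w => [|n IH] w; first by rewrite /partial_sum big_geq.
by rewrite partial_sumS/= le_max lerD2l IH orbT.
Qed.

(** Not immediate from the recursion, whose two sides sit at different points:
the induction compares the maxima of orders [n] and [m] at [T w]. *)
Lemma max_partial_sum_nondecreasing f n m w : (n <= m)%N ->
  max_partial_sum f n w <= max_partial_sum f m w.
Proof.
elim: n m w => [|n IH] [|m] w//= nm; first by rewrite le_max lexx.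
by rewrite ge_max le_max lexx/= le_max lerD2l IH// orbT.
Qed.

Definition unbounded_sums f : set Omega :=
  [set w | forall k, exists n, k%:R < max_partial_sum f n w].

(** Passing from [w] to [T w] changes each maximum by at most [|f w|], up to a
shift of the index and the truncation at [0]; so unboundedness is not
affected. *)
Lemma unbounded_sums_invariant f :
  T @^-1` unbounded_sums f = unbounded_sums f.
Proof.
apply/seteqP; split=> w wU k.
  have [n kn] := wU (Num.truncn (k%:R + `|f w|)).+1.
  exists n.+1 => /=; rewrite lt_max; apply/orP; right.
  have := lt_trans (truncnS_gt (k%:R + `|f w|)) kn.
  by have := ler_norm (- f w); rewrite normrN; lra.
have [[|n]] := wU (Num.truncn (k%:R + `|f w|)).+1 => /=.
  by rewrite ltrn0.
rewrite lt_max ltrn0/= => kn; exists n.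
have := lt_trans (truncnS_gt (k%:R + `|f w|)) kn.
by have := ler_norm (f w); lra.
Qed.

End partial_sum.

(** * The maximal inequality and its consequence *)

Section maximal_ergodic.
Context (d : measure_display) (Omega : measurableType d) (R : realType).
Context (P : probability Omega R) (T : Omega -> Omega).
Context (hT : measure_preserving P T).

Lemma integrable_max_partial_sum (f : Omega -> R) n :
  P.-integrable [set: Omega] (EFin \o f) ->
  P.-integrable [set: Omega] (EFin \o max_partial_sum T f n).
Proof.
move=> intf; elim: n => [|n IH]; first exact: integrable0.
have intS : P.-integrable [set: Omega]
    ((EFin \o f) \+ (EFin \o max_partial_sum T f n \o T)).
  by apply: integrableD => //; exact: integrable_comp_measure_preserving.
apply: le_integrable intS => //.
  apply/measurable_EFinP; apply: measurable_maxr => //.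
  apply: measurable_funD; first by apply/measurable_EFinP; case/integrableP: intf.
  apply: measurableT_comp; last by case: hT.
  by apply/measurable_EFinP; case/integrableP: IH.
move=> w _ /=; rewrite lee_fin.
case: (leP 0 (f w + max_partial_sum T f n (T w))) => // _.
by rewrite normr0.
Qed.

Lemma measurable_unbounded_sums (f : Omega -> R) :
  P.-integrable [set: Omega] (EFin \o f) -> measurable (unbounded_sums T f).
Proof.
move=> intf.
have -> : unbounded_sums T f =
    \bigcap_k \bigcup_n (max_partial_sum T f n @^-1` `]k%:R, +oo[).
  apply/seteqP; split=> w wU k => [_|].
    by have [n kn] := wU k; exists n => //=; rewrite in_itv/= kn.
  by have [n _ /=] := wU k I; rewrite in_itv/= andbT => kn; exists n.
apply: bigcap_measurable => // k _; apply: bigcup_measurable => n _.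
rewrite -[X in measurable X]setTI.
have /integrableP[/measurable_EFinP mf _] := integrable_max_partial_sum n intf.
exact: mf.
Qed.

(** The maximal ergodic inequality, directly in the limit of infinitely many
sums.  On the invariant set [A], the functions [g n = max(f, - M_n \o T)] equal
[M_{n+1} - M_n \o T], whose integral is that of [M_{n+1} - M_n]; and they are
eventually equal to [f] at each point, because [M_n] is unbounded on the whole
orbit. *)
Lemma integral_unbounded_sums_ge0 (f : Omega -> R) :
  P.-integrable [set: Omega] (EFin \o f) ->
  (0 <= \int[P]_(w in unbounded_sums T f) (f w)%:E)%E.
Proof.
move=> intf; set A := unbounded_sums T f.
have mA : measurable A by exact: measurable_unbounded_sums.
have TA : T @^-1` A = A by exact: unbounded_sums_invariant.
have intM n := integrable_max_partial_sum n intf.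
have intMT n := integrable_comp_measure_preserving hT (intM n).
pose g n w := Num.max (f w) (- max_partial_sum T f n (T w)).
have gE n w : g n w =
    max_partial_sum T f n.+1 w - max_partial_sum T f n (T w).
  by rewrite /g /= /Num.max; do 2 case: ifPn; rewrite -?leNgt; lra.
have g_ge0 n : (0 <= \int[P]_(w in A) (g n w)%:E)%E.
  under eq_integral do rewrite gE EFinB.
  rewrite integralB//; [|exact: integrableS (intM n.+1)|exact: integrableS (intMT n)].
  (* Invariance of [A] turns the second integral into one over [T @^-1` A], to
     which the change of variables applies. *)
  rewrite -[X in (_ - integral _ X _)%E]TA.
  rewrite (integral_comp_measure_preserving hT (intM n))//.
  rewrite -integralB//; [|exact: integrableS (intM n.+1)|exact: integrableS (intM n)].
  apply: integral_ge0 => w _; rewrite -EFinB lee_fin subr_ge0.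
  exact: max_partial_sum_nondecreasing.
have mf : measurable_fun [set: Omega] f.
  by apply/measurable_EFinP; case/integrableP: intf.
have gcvg : (\int[P]_(w in A) (g n w)%:E)%E @[n --> \oo] -->
            (\int[P]_(w in A) (f w)%:E)%E.
  apply: (@dominated_cvg _ _ _ _ _ mA (fun n => EFin \o g n) (EFin \o f)
    (abse \o (EFin \o f))).
  - move=> n; apply: measurable_funTS; apply/measurable_EFinP.
    apply: measurable_maxr => //; apply: measurableT_comp => //.
    by apply/measurable_EFinP; case/integrableP: (intMT n).
  (* [g n w = f w] as soon as [M_n (T w) >= - f w]. *)
  - move=> w Aw; have : A (T w) by rewrite -[A]TA in Aw.
    move=> /(_ (Num.truncn `|f w|).+1)[N wN].
    apply: cvg_near_cst; exists N => // n /= Nn; congr EFin.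
    apply/max_idPl; rewrite lerNl.
    have := @max_partial_sum_nondecreasing _ _ T f N n (T w) Nn.
    have := truncnS_gt `|f w|; have := ler_norm (- f w); rewrite normrN.
    by move: wN; lra.
  - by [].
  - by apply: integrable_abse; exact: integrableS intf.
  - move=> n w _ /=; rewrite lee_fin /g.
    rewrite ler_norml le_max ge_max ler_norm/= lerNl -normrN ler_norm/=.
    by rewrite (le_trans _ (normr_ge0 _))// oppr_le0 max_partial_sum_ge0.
rewrite -(cvg_lim _ gcvg)//; apply: lime_ge; first by apply/cvg_ex; eexists; exact: gcvg.
exact: nearW.
Qed.

(** Lowering [f] by a constant [e > 0] makes its integral over an invariant
event [A] equal to [- e * P A], which the maximal inequality forbids unless
[P A = 0], where [A] is the set on which the sums of [f - e] are unbounded. *)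
Lemma ae_partial_sum_le (f : Omega -> R) :
  P.-integrable [set: Omega] (EFin \o f) ->
  (forall A, invariant_events T A -> (\int[P]_(w in A) (f w)%:E = 0)%E) ->
  {ae P, forall w, forall e : R, 0 < e ->
    \forall n \near \oo, partial_sum (iterate_rv T f) n w <= e * n%:R}.
Proof.
move=> intf f0.
have bounded (e : R) : 0 < e ->
    {ae P, forall w, ~ unbounded_sums T (f \- cst e) w}.
  move=> e0; set A := unbounded_sums _ _.
  have inte : P.-integrable [set: Omega] (EFin \o cst e).
    exact: finite_measure_integrable_cst.
  have intg : P.-integrable [set: Omega] (EFin \o (f \- cst e)).
    rewrite (_ : EFin \o _ = (EFin \o f) \- (EFin \o cst e))%E//.
    exact: integrableB.
  have mA : measurable A by exact: measurable_unbounded_sums.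
  have TA : T @^-1` A = A by exact: unbounded_sums_invariant.
  exists A; split => //; last by move=> w /=; rewrite notK.
  have := integral_unbounded_sums_ge0 intg; rewrite -/A.
  under eq_integral do rewrite EFinB.
  rewrite integralB//=; [|exact: integrableS intf|exact: integrableS inte].
  rewrite f0// integral_cst// sub0e oppe_ge0 pmule_rle0 ?lte_fin// => PA.
  by apply/eqP; rewrite eq_le PA measure_ge0.
(* Countably many values [1 / (j + 1)] reduce the quantifier over [e] to a
   countable union of null sets; half of [e] absorbs the constant bound. *)
have := ae_foralln (fun j => bounded j.+1%:R^-1 (ltac:(by rewrite invr_gt0))).
apply: filterS => w wb e e0.
have [j je] : exists j, j.+1%:R^-1 < e / 2.
  exists (Num.truncn (e / 2)^-1); rewrite invf_plt ?posrE ?divr_gt0//.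
  exact: truncnS_gt.
have /existsNP[k kP] := wb j.
exists (Num.truncn (k%:R / (e / 2))).+1 => // n /= kn.
have kn' : k%:R <= e / 2 * n%:R.
  rewrite mulrC -ler_pdivrMr ?divr_gt0//.
  by rewrite (le_trans (ltW (truncnS_gt _)))// ler_nat.
have : max_partial_sum T (f \- cst j.+1%:R^-1) n w <= k%:R.
  by rewrite leNgt; apply/negP => kM; apply: kP; exists n.
move=> /(le_trans (partial_sum_le_max _ _ _ _)).
rewrite partial_sumB (@partial_sum_invariant _ _ _ (cst _))//=.
have : j.+1%:R^-1 * n%:R <= e / 2 * n%:R by rewrite ler_wpM2r// ltW.
by move: (_^-1 * n%:R) => c; lra.
Qed.

End maximal_ergodic.

Theorem theorem3 (d : measure_display) (Omega : measurableType d)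
    (R : realType) (P : probability Omega R)
    (T : Omega -> Omega) (hT : measure_preserving P T)
    (X1 : {RV P >-> R}) (hX1 : P.-integrable [set: Omega] (EFin \o X1))
    (Y : Omega -> R) (hY : is_cond_exp P (invariant_events T) X1 Y) :
  {ae P, forall w : Omega,
    (fun n : nat => partial_sum (iterate_rv T X1) n w / n%:R) @ \oo --> Y w}.
Proof.
have [YI intY YX] := hY.
(* The level set of [Y] through [w] is an invariant event, so it contains
   [T w]. *)
have YT w : Y (T w) = Y w.
  have [_ YTw] := YI [set Y w] (measurable_set1 _).
  by have /= : (T @^-1` (Y @^-1` [set Y w])) w by rewrite YTw.
have bound (f g : Omega -> R) :
    P.-integrable [set: Omega] (EFin \o f) ->
    P.-integrable [set: Omega] (EFin \o g) ->
    (forall A, invariant_events T A ->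
      \int[P]_(w in A) (f w)%:E = \int[P]_(w in A) (g w)%:E)%E ->
    {ae P, forall w, forall e : R, 0 < e -> \forall n \near \oo,
      partial_sum (iterate_rv T (f \- g)) n w <= e * n%:R}.
  move=> intf intg fg; apply: (ae_partial_sum_le hT) => [|A IA].
    rewrite (_ : EFin \o _ = (EFin \o f) \- (EFin \o g))%E//.
    exact: integrableB.
  have mA : measurable A by case: IA.
  have intfA : P.-integrable A (EFin \o f) by exact: integrableS intf.
  under eq_integral do rewrite EFinB.
  rewrite integralB//; last exact: integrableS intg.
  by rewrite -fg// subee// integrable_fin_num.
have ubound := bound _ _ hX1 intY (fun A IA => esym (YX A IA)).
have lbound := bound _ _ intY hX1 YX.
apply: filterS2 ubound lbound => w ub lb.
apply/cvgrPdist_le => e e0.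
near=> n.
have n0 : 0 < n%:R :> R by rewrite ltr0n; near: n; exists 1%N.
have : partial_sum (iterate_rv T (X1 \- Y)) n w <= e * n%:R.
  by near: n; exact: ub.
have : partial_sum (iterate_rv T (Y \- X1)) n w <= e * n%:R.
  by near: n; exact: lb.
rewrite !partial_sumB !(@partial_sum_invariant _ _ _ Y)// => lb' ub'.
rewrite -(ler_pM2r n0) -[X in _ * X <= _](gtr0_norm n0) -normrM mulrBl.
rewrite divfK ?gt_eqF// ler_norml; apply/andP; split; lra.
Unshelve. all: by end_near.
Qed.
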